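(* For every integer $i\ge 1$, the sequence $\{\sqrt[n]{d_i(i+n)}\}_{n\ge 1}$ is strictly log-convex; that is, for all integers $i\ge 1$ and $n\ge 1$, $$\frac{\sqrt[n+1]{d_i(i+n+1)}}{\sqrt[n]{d_i(i+n)}}<\frac{\sqrt[n+2]{d_i(i+n+2)}}{\sqrt[n+1]{d_i(i+n+1)}}.$$
   Context: For integers $m\ge 0$ and $0\le i\le m$, the Boros–Moll numbers are $$d_i(m)=2^{-2m}\sum_{k=i}^{m}2^k\binom{2m-2k}{m-k}\binom{m+k}{k}\binom{k}{i}.$$ *)

(* Defs.v *)
From Stdlib Require Import Reals List Lra Lia.
Open Scope R_scope.

Fixpoint binom (n k : nat) : nat :=
  match n, k with
  | _, O => 1%nat
  | O, S _ => 0%nat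
  | S n', S k' => (binom n' k' + binom n' k)%nat
  end.

Definition bm_d (i m : nat) : R :=
  / (2 ^ (2 * m)) *
  fold_right Rplus 0
    (map (fun k => 2 ^ k * INR (binom (2 * m - 2 * k) (m - k))
                       * INR (binom (m + k) k) * INR (binom k i))
         (seq i (S m - i))).

Definition nroot (n : nat) (x : R) : R := Rpower x (/ INR n).

(* Main.v *)
Require Import Defs.
From Stdlib Require Import Reals.
From Stdlib Require Import List Lra Lia Arith.
Open Scope R_scope.

(** Fix [i] and put [a n := d_i(i+n)], [u n := ln (a (n+1)) - ln (a n)].  The
    second difference of [ln (a n) / n], multiplied by [n (n+1) (n+2)], equals
    [2 ln (a 0) >= 0] at [n = 0] and increases with [n] as soon as [u] is
    strictly convex.  So it suffices that the ratios [r n := a (n+1) / a n] satisfy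
    [r (n+1)^2 < r n * r (n+2)].  By the three-term recurrence of [d_i(m)] in [m],
    proved by creative telescoping, the outer two ratios are rational functions
    of the middle one, and the inequality becomes a quartic one in [r (n+1)].
    With [N := i + n + 1], the normalised ratio [p n := 2 N (N - i) r n] obeys
    [p n * p (n+1) = C p n - K]; this map preserves the lower bound
    [4 N^2 - N + i + i^2 n / (i^2 + 2 i + n)], an equality at [n = 0], and the
    quartic is positive from that bound on: after the shift [i = 1 + j] all
    the polynomials involved have nonnegative coefficients. *)

(** * Polynomial positivity *)

Ltac nonneg :=
  repeat first [ assumption | apply Rplus_le_le_0_compat
               | apply Rmult_le_pos | apply pow_le | lra ].

(** After expansion every monomial is nonnegative; in the strict case the last summand is a positive
    constant. *)
Ltac coeff_pos :=
  match goal with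
  | |- 0 < ?e => ring_simplify e; apply Rplus_le_lt_0_compat; [nonneg | lra]
  | |- 0 <= ?e => ring_simplify e; nonneg
  end.

Definition rec_C (i N : R) : R := 8 * N ^ 2 + 8 * N + 3 - 4 * i ^ 2.
Definition rec_K (i N : R) : R := (16 * N ^ 2 - 1) * (N ^ 2 - i ^ 2).
Definition base (i N : R) : R := 4 * N ^ 2 - N + i.

Definition lower (i n : R) : R :=
  base i (i + n + 1) + i ^ 2 * n / (i ^ 2 + 2 * i + n).

(** The map sending [p] to [C - K / p] is increasing for [K >= 0], so the induction step for the
    lower bound need only be checked at the bound itself. The product form avoids division, and the
    sign of its first factor extends it to every [p] above [lower i n]. *)
Lemma lower_invariant (i n : R) : 1 <= i -> 0 <= n ->
  0 <= rec_C i (i + n + 1) - lower i (n + 1) /\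
  rec_K i (i + n + 1)
    <= (rec_C i (i + n + 1) - lower i (n + 1)) * lower i n.
Proof.
  intros Hi Hn.
  assert (Hd : 0 < i ^ 2 + 2 * i + n) by nra.
  assert (Hd' : 0 < i ^ 2 + 2 * i + (n + 1)) by nra.
  set (N := i + n + 1).
  set (A := (rec_C i N - base i (N + 1)) * (i ^ 2 + 2 * i + (n + 1))
              - i ^ 2 * (n + 1)).
  set (B := base i N * (i ^ 2 + 2 * i + n) + i ^ 2 * n).
  assert (EA : rec_C i N - lower i (n + 1) = A / (i ^ 2 + 2 * i + (n + 1))).
  { unfold A, lower. replace (i + (n + 1) + 1) with (N + 1) by (unfold N; ring).
    field. lra. }
  assert (EB : lower i n = B / (i ^ 2 + 2 * i + n)).
  { unfold B, lower. fold N. field. lra. }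
  rewrite EA, EB.
  assert (HA : 0 <= A).
  { unfold A, rec_C, base, N.
    replace i with (1 + (i - 1)) by ring.
    set (j := i - 1). assert (Hj : 0 <= j) by (unfold j; lra); clearbody j.
    coeff_pos. }
  assert (HAB : 0 <= A * B - rec_K i N
                   * ((i ^ 2 + 2 * i + (n + 1)) * (i ^ 2 + 2 * i + n))).
  { unfold A, B, rec_C, rec_K, base, N.
    replace i with (1 + (i - 1)) by ring.
    set (j := i - 1). assert (Hj : 0 <= j) by (unfold j; lra); clearbody j.
    coeff_pos. }
  split.
  - apply Rmult_le_pos; [exact HA | left; apply Rinv_0_lt_compat; exact Hd'].
  - apply Rmult_le_reg_r with ((i ^ 2 + 2 * i + (n + 1)) * (i ^ 2 + 2 * i + n)).
    + apply Rmult_lt_0_compat; assumption.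
    + apply Rle_trans with (A * B); [lra | right; field; lra].
Qed.

Lemma lower_pos (i n : R) : 1 <= i -> 0 <= n -> 0 < lower i n.
Proof.
  intros Hi Hn. unfold lower, base.
  assert (0 <= i ^ 2 * n / (i ^ 2 + 2 * i + n)).
  { apply Rmult_le_pos; [apply Rmult_le_pos; [apply pow_le|]; lra |].
    left; apply Rinv_0_lt_compat; nra. }
  nra.
Qed.

(* [M] stands for [i + n + 2], and [p] for the middle of three consecutive
   normalised ratios, the outer two being eliminated by the recurrence. *)
Lemma ratio_quartic_pos (i n p : R) : 1 <= i -> 0 <= n -> lower i (n + 1) <= p ->
  let M := i + n + 2 in
  p ^ 3 * (rec_C i (M - 1) - p) * ((M - 1) * (M + 1) * (M - i + 1)) <
  (16 * (M - 1) ^ 2 - 1) * (M - 1 + i) * (rec_C i M * p - rec_K i M)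
    * (M ^ 2 * (M - i) ^ 2).
Proof.
  intros Hi Hn Hp M.
  assert (Hd : 0 < i ^ 2 + 2 * i + (n + 1)) by nra.
  set (p0 := base i M). set (C := rec_C i (M - 1)). set (C' := rec_C i M).
  set (K' := rec_K i M).
  set (U := (16 * (M - 1) ^ 2 - 1) * (M - 1 + i) * (M ^ 2 * (M - i) ^ 2)).
  set (V := (M - 1) * (M + 1) * (M - i + 1)).
  set (d := i ^ 2 + 2 * i + (n + 1)).
  set (x := p - p0).
  (* The bound on [p], cleared of its denominator [d]. *)
  assert (Hx : 0 <= x * d - i ^ 2 * (n + 1)).
  { assert (E : lower i (n + 1) = p0 + i ^ 2 * (n + 1) / d).
    { unfold lower, p0, M. f_equal. f_equal. ring. }
    assert (E2 : i ^ 2 * (n + 1) = i ^ 2 * (n + 1) / d * d)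
      by (field; unfold d; lra).
    rewrite E in Hp. rewrite E2, <- Rmult_minus_distr_r. apply Rmult_le_pos; [unfold x | unfold d]; lra. }
  assert (Hx0 : 0 <= x).
  { apply Rmult_le_reg_r with d; [exact Hd|].
    assert (0 <= i ^ 2 * (n + 1)) by (apply Rmult_le_pos; [apply pow_le|]; lra).
    lra. }
  (* The Taylor coefficients of the quartic at [p0]. *)
  set (g0 := U * (C' * p0 - K') - V * p0 ^ 3 * (C - p0)).
  set (g1 := U * C' - V * p0 ^ 2 * (3 * C - 4 * p0)).
  set (g2 := 3 * V * p0 * (2 * p0 - C)).
  set (g3 := V * (4 * p0 - C)).
  assert (Hg1 : 0 <= g1).
  { unfold g1, U, V, C, C', p0, rec_C, base, M.
    replace i with (1 + (i - 1)) by ring.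
    set (j := i - 1). assert (Hj : 0 <= j) by (unfold j; lra); clearbody j.
    coeff_pos. }
  (* [d] times the linear Taylor part at the least admissible shift, [x = i ^ 2 * (n + 1) / d]. *)
  assert (Hg01 : 0 < d * g0 + i ^ 2 * (n + 1) * g1).
  { unfold d, g0, g1, U, V, C, C', K', p0, rec_C, rec_K, base, M.
    replace i with (1 + (i - 1)) by ring.
    set (j := i - 1). assert (Hj : 0 <= j) by (unfold j; lra); clearbody j.
    coeff_pos. }
  assert (HV : 0 <= V) by (unfold V, M; repeat apply Rmult_le_pos; lra).
  assert (Hp0 : 0 <= p0) by (unfold p0, base, M; nra).
  assert (Hq : 0 <= 2 * p0 - C).
  { replace (2 * p0 - C) with (6 * M + 2 * i + 4 * i ^ 2 - 3)
      by (unfold p0, C, rec_C, base; ring).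
    assert (0 <= i ^ 2) by (apply pow_le; lra). unfold M. lra. }
  assert (Hg2 : 0 <= g2) by (unfold g2; nonneg).
  assert (Hg3 : 0 <= g3) by (unfold g3; apply Rmult_le_pos; lra).
  apply Rlt_0_minus. apply Rmult_lt_reg_l with d; [exact Hd|].
  rewrite Rmult_0_r.
  (* The linear part is split into its value at the least shift and [g1] times the excess. *)
  replace (d * _) with
    (d * g0 + i ^ 2 * (n + 1) * g1 + g1 * (x * d - i ^ 2 * (n + 1))
       + d * (g2 * x ^ 2 + g3 * x ^ 3 + V * x ^ 4)).
  - apply Rplus_lt_le_0_compat; [apply Rplus_lt_le_0_compat|].
    + exact Hg01.
    + apply Rmult_le_pos; assumption.
    + unfold d. assert (0 <= x ^ 2) by (apply pow_le; exact Hx0).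
      assert (0 <= x ^ 3) by (apply pow_le; exact Hx0).
      assert (0 <= x ^ 4) by (apply pow_le; exact Hx0).
      apply Rmult_le_pos; [lra|].
      repeat apply Rplus_le_le_0_compat; apply Rmult_le_pos; assumption.
  - replace p with (p0 + x) by (unfold x; ring).
    unfold g0, g1, g2, g3. unfold U. fold V. ring.
Qed.

(** * Binomial coefficients *)

(** Double induction along Pascal's rule, whose two terms are covered by the inner hypothesis at [k]
    and the outer one at [S k]. *)
Lemma binom_fact (n k : nat) : (binom (n + k) k * (fact n * fact k) = fact (n + k))%nat.
Proof.
  revert k. induction n as [|n IHn]; intros k.
  - simpl. rewrite Nat.add_0_r.
    assert (H : forall k, binom k k = 1%nat /\ forall l, (k < l)%nat -> binom k l = 0%nat).
    { clear. induction k as [|k [IH1 IH2]]; split; try reflexivity.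
      - intros [|l] Hl; [lia | reflexivity].
      - simpl. rewrite IH1, IH2; lia.
      - intros [|l] Hl; [lia|]. simpl. rewrite !IH2; lia. }
    rewrite (proj1 (H k)). lia.
  - induction k as [|k IHk].
    + rewrite Nat.add_0_r. simpl. lia.
    + replace (S n + S k)%nat with (S (S n + k)) by lia.
      change (binom (S (S n + k)) (S k))
        with (binom (S n + k) k + binom (S n + k) (S k))%nat.
      specialize (IHn (S k)).
      replace (n + S k)%nat with (S n + k)%nat in IHn by lia.
      change (fact (S (S n + k))) with (S (S n + k) * fact (S n + k))%nat.
      change (fact (S k)) with (S k * fact k)%nat in *.
      change (fact (S n)) with (S n * fact n)%nat in *.
      (* The factor [S (S n + k)] splits as [S k + S n], one part for each Pascal term. *)
      transitivity (S k * fact (S n + k) + S n * fact (S n + k))%nat;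
        [rewrite <- IHk at 1; rewrite <- IHn at 1; ring | simpl; ring].
Qed.

Definition bin (n k : nat) : R := INR (binom n k).

Lemma bin_fact (n k : nat) : bin (n + k) k = INR (fact (n + k)) / (INR (fact n) * INR (fact k)).
Proof.
  unfold bin. rewrite <- binom_fact, !mult_INR. field.
  split; apply INR_fact_neq_0.
Qed.

Lemma bin_pos (n k : nat) : (k <= n)%nat -> 0 < bin n k.
Proof.
  intros H. replace n with (n - k + k)%nat by lia. rewrite bin_fact.
  apply Rdiv_lt_0_compat; [|apply Rmult_lt_0_compat]; apply INR_fact_lt_0.
Qed.

Lemma fact_S_INR (n : nat) : INR (fact (S n)) = (INR n + 1) * INR (fact n).
Proof. rewrite fact_simpl, mult_INR, S_INR. reflexivity. Qed.

Lemma bin_add_succ_l (m k : nat) :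
  (INR m + 1) * bin (S m + k) k = (INR m + INR k + 1) * bin (m + k) k.
Proof.
  rewrite !bin_fact, fact_S_INR. simpl Nat.add. rewrite fact_S_INR, plus_INR.
  pose proof (pos_INR m). field. repeat split; try apply INR_fact_neq_0. lra.
Qed.

Lemma bin_add_succ_r (m k : nat) :
  (INR k + 1) * bin (m + S k) (S k) = (INR m + INR k + 1) * bin (m + k) k.
Proof.
  rewrite !bin_fact, fact_S_INR. rewrite Nat.add_succ_r, fact_S_INR, plus_INR.
  pose proof (pos_INR k). field. repeat split; try apply INR_fact_neq_0. lra.
Qed.

Lemma bin_succ_top (i k : nat) : (i <= k)%nat ->
  (INR k + 1 - INR i) * bin (S k) i = (INR k + 1) * bin k i.
Proof.
  intros H. replace k with (k - i + i)%nat by lia. generalize (k - i)%nat. intros l.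
  pose proof (bin_add_succ_l l i) as E. rewrite plus_INR.
  replace (INR l + INR i + 1 - INR i) with (INR l + 1) by ring.
  exact E.
Qed.

Definition central (l : nat) : R := bin (2 * l) l.

Lemma central_succ (l : nat) :
  (INR l + 1) * central (S l) = 2 * (2 * INR l + 1) * central l.
Proof.
  unfold central. replace (2 * S l)%nat with (S l + S l)%nat by lia.
  replace (2 * l)%nat with (l + l)%nat by lia.
  rewrite !bin_fact, fact_S_INR. simpl Nat.add.
  rewrite Nat.add_succ_r, !fact_S_INR, S_INR, plus_INR.
  pose proof (pos_INR l). field. split; [apply INR_fact_neq_0 | lra].
Qed.

(** Consecutive central coefficients have ratio [2 (2l+1) / (l+1)], which is at least 2. *)
Lemma central_ge (l : nat) : 2 ^ l <= central l.
Proof.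
  induction l as [|l IH].
  - unfold central, bin. simpl. lra.
  - pose proof (central_succ l) as E. pose proof (pos_INR l) as Hl.
    assert (0 < 2 ^ l) by (apply pow_lt; lra).
    apply Rmult_le_reg_l with (INR l + 1); [lra|]. rewrite E. simpl. nra.
Qed.

(* Extending the central binomial coefficient [binom (2m-2k) (m-k)] by zero to
   [k > m] makes its recurrence, hence the telescoping below, hold for all [k]. *)
Definition cent (m k : nat) : R := if Nat.leb k m then central (m - k) else 0.

Lemma cent_succ (m k : nat) :
  (INR m + 1 - INR k) * cent (S m) k = 2 * (2 * INR m - 2 * INR k + 1) * cent m k.
Proof.
  unfold cent. destruct (Nat.leb_spec k m), (Nat.leb_spec k (S m)); try lia.
  - replace (S m - k)%nat with (S (m - k)) by lia.
    pose proof (central_succ (m - k)) as E. rewrite minus_INR in E by lia.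
    replace (INR m + 1 - INR k) with (INR m - INR k + 1) by ring. rewrite E. ring.
  - replace k with (S m) by lia. rewrite S_INR. ring.
  - ring.
Qed.

(** * The recurrence *)

Definition sum_from (i len : nat) (f : nat -> R) : R :=
  fold_right Rplus 0 (map f (seq i len)).

Lemma sum_from_succ (i len : nat) (f : nat -> R) :
  sum_from i (S len) f = sum_from i len f + f (i + len)%nat.
Proof.
  unfold sum_from. rewrite seq_S, map_app, fold_right_app. simpl.
  generalize (map f (seq i len)). intros s.
  induction s as [|x s IH]; simpl; [ring | rewrite IH; ring].
Qed.

Lemma sum_from_telescope (i len : nat) (f g : nat -> R) :
  (forall k, (i <= k)%nat -> f k = g (S k) - g k) ->
  sum_from i len f = g (i + len)%nat - g i.
Proof.
  intros H. induction len as [|len IH].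
  - unfold sum_from. simpl. rewrite Nat.add_0_r. ring.
  - rewrite sum_from_succ, IH, H by lia. rewrite Nat.add_succ_r. ring.
Qed.

Lemma sum_from_lin3 (i len : nat) (x y z : R) (f g h : nat -> R) :
  sum_from i len (fun k => x * f k + y * g k + z * h k)
  = x * sum_from i len f + y * sum_from i len g + z * sum_from i len h.
Proof.
  induction len as [|len IH].
  - unfold sum_from. simpl. ring.
  - rewrite !sum_from_succ, IH. ring.
Qed.

Definition summand (i m k : nat) : R := 2 ^ k * cent m k * bin (m + k) k * bin k i.

Lemma summand_vanish (i m k : nat) : (m < k)%nat -> summand i m k = 0.
Proof.
  intros H. unfold summand, cent. destruct (Nat.leb_spec k m); [lia | ring].
Qed.

Lemma sum_from_vanish (i len l : nat) (f : nat -> R) :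
  (forall k, (i + len <= k)%nat -> f k = 0) -> sum_from i (len + l) f = sum_from i len f.
Proof.
  intros H. induction l as [|l IH]; [now rewrite Nat.add_0_r|].
  rewrite Nat.add_succ_r, sum_from_succ, IH, H by lia. ring.
Qed.

(** The spare length [l] pads with zeros, so that sums for different [n] can share one range. *)
Lemma bm_d_sum (i n l : nat) :
  bm_d i (i + n) = / 2 ^ (2 * (i + n)) * sum_from i (S n + l) (summand i (i + n)).
Proof.
  rewrite sum_from_vanish by (intros k Hk; apply summand_vanish; lia).
  unfold bm_d, sum_from. replace (S (i + n) - i)%nat with (S n) by lia.
  f_equal. f_equal. apply map_ext_in. intros k Hk. apply in_seq in Hk.
  unfold summand, cent, central, bin. destruct (Nat.leb_spec k (i + n)); [|lia].
  replace (2 * (i + n - k))%nat with (2 * (i + n) - 2 * k)%nat by lia. reflexivity.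
Qed.

(** Parity keeps the denominators of the certificate nonzero even for [k > m]. *)
Lemma odd_ne_0 (a b c : nat) : 2 * INR a - 2 * INR b + (2 * INR c + 1) <> 0.
Proof.
  rewrite !INR_IZR_INZ, <- !mult_IZR, <- minus_IZR, <- !plus_IZR.
  intros H. apply eq_IZR in H. lia.
Qed.

(* Obtained from Zeilberger's algorithm; the quadratic factor is in Newton form
   at the nodes [k = m + 1] and [k = m + 2]. *)
Definition cert (i m k : nat) : R :=
  let x := INR k - INR m in
  (INR k - INR i) / (4 * (3 - 2 * x)) *
  ((2 * INR m + 2) * (2 * INR m + 1 + 4 * INR i)
   + (x - 1) * (8 * INR m + 10 - 8 * INR i * (INR m + 1))
   + (x - 1) * (x - 2) * 4 * (INR m + 2 - INR i))
  * (2 ^ k * cent (S (S m)) k * bin (m + k) k * bin k i).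

(** The coefficients are those of [bm_d_rec] with [N = m + 1], rescaled by the powers of 4 in the
    prefactor of [bm_d]. Once all terms are multiples of one hypergeometric term, a rational
    identity remains. *)
Lemma summand_cert (i m k : nat) : (i <= k)%nat ->
  (INR m + 2 - INR i) * (INR m + 1) * (INR m + 2) / 4 * summand i (S (S m)) k
  + - ((INR m + 1) * (8 * INR m ^ 2 + 24 * INR m + 19 - 4 * INR i ^ 2) / 2)
      * summand i (S m) k
  + (INR m + INR i + 1) * (4 * INR m + 3) * (4 * INR m + 5) * summand i m k
  = cert i m (S k) - cert i m k.
Proof.
  intros Hik. unfold summand, cert. cbv zeta.
  pose proof (pos_INR m) as Hm. pose proof (pos_INR k) as Hk.
  pose proof (odd_ne_0 m k 0) as O1. pose proof (odd_ne_0 m k 1) as O3.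
  simpl INR in O1, O3.
  assert (Ec : cent (S (S m)) (S k) = cent (S m) k) by reflexivity.
  pose proof (cent_succ m k) as E0. pose proof (cent_succ (S m) k) as E1.
  rewrite S_INR in E1.
  assert (F1 : cent (S m) k = (INR m + 2 - INR k)
             / (2 * (2 * INR m - 2 * INR k + 3)) * cent (S (S m)) k).
  { apply Rmult_eq_reg_l with (2 * (2 * INR m - 2 * INR k + 3)); [|lra].
    transitivity ((INR m + 1 + 1 - INR k) * cent (S (S m)) k);
      [rewrite E1; ring | field; lra]. }
  assert (F0 : cent m k = (INR m + 1 - INR k)
             / (2 * (2 * INR m - 2 * INR k + 1)) * cent (S m) k).
  { apply Rmult_eq_reg_l with (2 * (2 * INR m - 2 * INR k + 1)); [|lra].
    rewrite <- E0. field; lra. }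
  assert (B1 : bin (S m + k) k
             = (INR m + INR k + 1) / (INR m + 1) * bin (m + k) k).
  { apply Rmult_eq_reg_l with (INR m + 1); [|lra].
    rewrite bin_add_succ_l. field; lra. }
  assert (B2 : bin (S (S m) + k) k
             = (INR m + INR k + 2) / (INR m + 2) * bin (S m + k) k).
  { apply Rmult_eq_reg_l with (INR (S m) + 1); [|rewrite S_INR; lra].
    rewrite bin_add_succ_l, S_INR. field; lra. }
  (* The factor [k + 1 - i] of the shifted certificate absorbs the denominator of
     [bin (S k) i / bin k i]. *)
  assert (T : (INR (S k) - INR i) * (bin (m + S k) (S k) * bin (S k) i)
            = (INR m + INR k + 1) * (bin (m + k) k * bin k i)).
  { apply Rmult_eq_reg_l with (INR k + 1); [|lra].
    transitivity (((INR k + 1) * bin (m + S k) (S k))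
                  * ((INR k + 1 - INR i) * bin (S k) i)); [rewrite S_INR; ring|].
    rewrite bin_add_succ_r, bin_succ_top by exact Hik. ring. }
  set (Q := fun x : R => (2 * INR m + 2) * (2 * INR m + 1 + 4 * INR i)
   + (x - 1) * (8 * INR m + 10 - 8 * INR i * (INR m + 1))
   + (x - 1) * (x - 2) * 4 * (INR m + 2 - INR i)).
  transitivity (/ (4 * (3 - 2 * (INR (S k) - INR m))) * Q (INR (S k) - INR m)
    * (2 ^ S k * cent (S m) k)
    * ((INR (S k) - INR i) * (bin (m + S k) (S k) * bin (S k) i))
    - (INR k - INR i) / (4 * (3 - 2 * (INR k - INR m))) * Q (INR k - INR m)
      * (2 ^ k * cent (S (S m)) k * bin (m + k) k * bin k i));
    [| rewrite Ec; unfold Q, Rdiv; ring].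
  rewrite T, B2, B1, F0, F1, S_INR. simpl pow. unfold Q.
  field. repeat split; lra.
Qed.

Lemma bm_d_rec (i n : nat) :
  let N := INR i + INR n + 1 in
  4 * (N + 1 - INR i) * N * (N + 1) * bm_d i (i + S (S n))
  = 2 * N * rec_C (INR i) N * bm_d i (i + S n)
    - (N + INR i) * (16 * N ^ 2 - 1) * bm_d i (i + n).
Proof.
  intros N.
  rewrite (bm_d_sum i (S (S n)) 0), (bm_d_sum i (S n) 1), (bm_d_sum i n 2).
  replace (S (S (S n)) + 0)%nat with (n + 3)%nat by lia.
  replace (S (S n) + 1)%nat with (n + 3)%nat by lia.
  replace (S n + 2)%nat with (n + 3)%nat by lia.
  replace (i + S (S n))%nat with (S (S (i + n))) by lia.
  replace (i + S n)%nat with (S (i + n)) by lia.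
  set (m := (i + n)%nat).
  assert (EN : INR m = N - 1) by (unfold m, N; rewrite plus_INR; ring).
  pose proof (sum_from_telescope i (n + 3) _ _ (summand_cert i m)) as T.
  rewrite sum_from_lin3 in T.
  (* The lower boundary term dies by the factor [k - i], the upper one because [cent (m + 2)]
     vanishes at [k = m + 3]. *)
  assert (Z0 : cert i m i = 0).
  { unfold cert. cbv zeta. unfold Rdiv. ring. }
  assert (Z1 : cert i m (i + (n + 3)) = 0).
  { unfold cert, cent. destruct (Nat.leb_spec (i + (n + 3)) (S (S m))); [unfold m in *; lia|].
    cbv zeta. ring. }
  rewrite Z0, Z1, EN in T.
  replace (2 * S (S m))%nat with (2 * m + 4)%nat by lia.
  replace (2 * S m)%nat with (2 * m + 2)%nat by lia.
  rewrite !pow_add.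
  assert (H2 : 2 ^ (2 * m) <> 0) by (apply pow_nonzero; lra).
  apply Rmult_eq_reg_l with (2 ^ (2 * m)); [|exact H2].
  apply Rminus_diag_uniq.
  (* The right-hand 0 is replaced by the telescoped combination of sums. *)
  rewrite <- (Rminus_diag_eq 0 0 eq_refl), <- T at 1.
  unfold rec_C. field. exact H2.
Qed.

(** * Ratio log-convexity *)

Lemma bm_d_pos (i n : nat) : 0 < bm_d i (i + n).
Proof.
  rewrite (bm_d_sum i n 0). rewrite Nat.add_0_r.
  apply Rmult_lt_0_compat; [apply Rinv_0_lt_compat, pow_lt; lra|].
  assert (H : forall k, (i <= k <= i + n)%nat -> 0 < summand i (i + n) k).
  { intros k Hk. unfold summand, cent, central.
    destruct (Nat.leb_spec k (i + n)); [|lia].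
    repeat apply Rmult_lt_0_compat; try (apply bin_pos; lia).
    apply pow_lt; lra. }
  assert (G : forall l, (l <= n)%nat -> 0 < sum_from i (S l) (summand i (i + n))).
  { induction l as [|l IH]; intros Hl; rewrite sum_from_succ.
    - unfold sum_from. simpl. rewrite Rplus_0_l. apply H. lia.
    - apply Rplus_lt_0_compat; [apply IH | apply H]; lia. }
  apply G. lia.
Qed.

Lemma bin_n_n (n : nat) : bin n n = 1.
Proof.
  change (bin (0 + n) n = 1). rewrite bin_fact. simpl. field. apply INR_fact_neq_0.
Qed.

Lemma bm_d_diag (i : nat) : bm_d i (i + 0) = / 2 ^ i * central i.
Proof.
  rewrite (bm_d_sum i 0 0). unfold sum_from, summand, cent. simpl seq. simpl map.
  simpl fold_right. rewrite Nat.add_0_r, Nat.leb_refl, Nat.sub_diag, bin_n_n.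
  replace (2 * i)%nat with (i + i)%nat by lia. rewrite pow_add.
  unfold central. replace (2 * i)%nat with (i + i)%nat by lia.
  replace (bin (2 * 0) 0) with 1 by reflexivity.
  field. apply pow_nonzero. lra.
Qed.

Lemma bm_d_diag_ge1 (i : nat) : 1 <= bm_d i (i + 0).
Proof.
  rewrite bm_d_diag. assert (0 < 2 ^ i) by (apply pow_lt; lra).
  apply Rmult_le_reg_l with (2 ^ i); [assumption|].
  pose proof (central_ge i). rewrite <- Rmult_assoc, Rinv_r; lra.
Qed.

(** The two-term sum is evaluated directly; it gives the initial value [(2i+1)(2i+3)] of
    [nratio i]. *)
Lemma bm_d_subdiag (i : nat) :
  2 * (INR i + 1) * bm_d i (i + 1) = (2 * INR i + 1) * (2 * INR i + 3) * bm_d i (i + 0).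
Proof.
  rewrite bm_d_diag, (bm_d_sum i 1 0). unfold sum_from, summand, cent.
  simpl seq. simpl map. simpl fold_right.
  replace (i + 1)%nat with (S i) by lia.
  rewrite Nat.leb_refl. destruct (Nat.leb_spec i (S i)); [|lia].
  replace (S i - i)%nat with 1%nat by lia. rewrite Nat.sub_diag, bin_n_n.
  replace (central 1) with 2 by (unfold central, bin; simpl; ring).
  replace (central 0) with 1 by reflexivity.
  pose proof (pos_INR i) as Hi.
  assert (E1 : bin (S i + i) i = (2 * INR i + 1) / (INR i + 1) * central i).
  { apply Rmult_eq_reg_l with (INR i + 1); [|lra].
    rewrite bin_add_succ_l. unfold central. replace (2 * i)%nat with (i + i)%nat by lia.
    field. lra. }
  assert (E2 : bin (S i + S i) (S i) = 2 * (2 * INR i + 1) / (INR i + 1) * central i).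
  { apply Rmult_eq_reg_l with (INR i + 1); [|lra].
    replace (S i + S i)%nat with (2 * S i)%nat by lia.
    fold (central (S i)). rewrite central_succ. field. lra. }
  assert (E3 : bin (S i) i = INR i + 1).
  { pose proof (bin_succ_top i i (le_n i)) as E. rewrite bin_n_n in E. lra. }
  rewrite E1, E2, E3.
  replace (2 * S i)%nat with (i + i + 2)%nat by lia. rewrite !pow_add. simpl pow.
  field. split; [apply pow_nonzero|]; lra.
Qed.

(** This scaling makes the ratio form of the recurrence monic. *)
Definition nratio (i n : nat) : R :=
  2 * (INR i + INR n + 1) * (INR n + 1) * bm_d i (i + S n) / bm_d i (i + n).

Lemma nratio_rec (i n : nat) :
  nratio i n * nratio i (S n)
  = rec_C (INR i) (INR i + INR n + 1) * nratio i n - rec_K (INR i) (INR i + INR n + 1).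
Proof.
  unfold nratio. pose proof (bm_d_rec i n) as E. cbv zeta in E.
  pose proof (bm_d_pos i n). pose proof (bm_d_pos i (S n)).
  rewrite S_INR. unfold rec_K.
  set (N := INR i + INR n + 1) in *. replace (INR i + (INR n + 1) + 1) with (N + 1) by (unfold N; ring).
  replace (INR n) with (N - INR i - 1) by (unfold N; ring).
  apply Rmult_eq_reg_l with (bm_d i (i + n)); [|lra].
  transitivity ((N - INR i) *
    (4 * (N + 1 - INR i) * N * (N + 1) * bm_d i (i + S (S n)))); [field; lra|].
  rewrite E. field. lra.
Qed.

Lemma nratio_lower (i n : nat) : (1 <= i)%nat -> lower (INR i) (INR n) <= nratio i n.
Proof.
  intros Hi. apply le_INR in Hi. simpl in Hi.
  induction n as [|n IH].
  - right. unfold lower, base, nratio. simpl INR.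
    pose proof (bm_d_subdiag i) as E. pose proof (bm_d_pos i 0) as H0.
    apply Rmult_eq_reg_r with (bm_d i (i + 0)); [|lra].
    transitivity (2 * (INR i + 1) * bm_d i (i + 1)).
    + rewrite E. field. nra.
    + field. lra.
  - pose proof (pos_INR n) as Hn.
    pose proof (lower_pos (INR i) (INR n) Hi Hn) as Hpos.
    pose proof (nratio_rec i n) as E.
    destruct (lower_invariant (INR i) (INR n) Hi Hn) as [H1 H2].
    (* Multiplying by [nratio i n] turns the goal into [lower' * p <= C * p - K]. *)
    rewrite S_INR. apply Rmult_le_reg_l with (nratio i n); [lra|].
    rewrite E. pose proof (Rmult_le_compat_l _ _ _ H1 IH). lra.
Qed.

(** This is [r (n+1)^2 < r n * r (n+2)] cleared of denominators. *)
Lemma bm_d_ratio_log_convex (i n : nat) : (1 <= i)%nat ->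
  bm_d i (i + n) * bm_d i (i + S (S n)) ^ 3
  < bm_d i (i + S (S (S n))) * bm_d i (i + S n) ^ 3.
Proof.
  intros Hi. assert (Hi' := Hi). apply le_INR in Hi'. simpl in Hi'.
  pose proof (pos_INR n) as Hn.
  pose proof (nratio_lower i (S n) Hi) as HL. rewrite S_INR in HL.
  pose proof (ratio_quartic_pos (INR i) (INR n) _ Hi' Hn HL) as HQ. cbv zeta in HQ.
  pose proof (nratio_rec i n) as E0. pose proof (nratio_rec i (S n)) as E1.
  rewrite S_INR in E1.
  set (M := INR i + INR n + 2) in *.
  replace (INR i + INR n + 1) with (M - 1) in E0 by (unfold M; ring).
  replace (INR i + (INR n + 1) + 1) with M in E1 by (unfold M; ring).
  rewrite <- E1 in HQ.
  assert (P : forall k, 0 < nratio i k).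
  { intros k. pose proof (nratio_lower i k Hi).
    pose proof (lower_pos (INR i) (INR k) Hi' (pos_INR k)). lra. }
  pose proof (P n) as P0. pose proof (P (S n)) as P1. pose proof (P (S (S n))) as P2.
  (* The recurrence read backwards restores the first ratio in the quartic inequality. *)
  assert (F : rec_C (INR i) (M - 1) - nratio i (S n)
              = rec_K (INR i) (M - 1) / nratio i n).
  { apply Rmult_eq_reg_l with (nratio i n); [|lra].
    rewrite Rmult_minus_distr_l, E0. field. lra. }
  rewrite F in HQ. unfold rec_K in HQ.
  assert (HM : M - 1 - INR i = INR n + 1) by (unfold M; ring).
  assert (R : nratio i (S n) ^ 2 * ((M - 1) * (M + 1) * (M - INR i + 1) * (M - 1 - INR i))
              < nratio i n * nratio i (S (S n)) * (M ^ 2 * (M - INR i) ^ 2)).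
  { set (c := (16 * (M - 1) ^ 2 - 1) * (M - 1 + INR i) * nratio i (S n) / nratio i n).
    assert (Hc : 0 < c).
    { unfold c. apply Rdiv_lt_0_compat; [|exact P0].
      apply Rmult_lt_0_compat; [|exact P1].
      apply Rmult_lt_0_compat; unfold M; nra. }
    apply Rmult_lt_reg_l with c; [exact Hc|].
    eapply Rle_lt_trans; [|eapply Rlt_le_trans; [exact HQ|]];
      right; unfold c; field; lra. }
  unfold nratio in R. rewrite !S_INR in R.
  pose proof (bm_d_pos i n) as A0. pose proof (bm_d_pos i (S n)) as A1.
  pose proof (bm_d_pos i (S (S n))) as A2. pose proof (bm_d_pos i (S (S (S n)))) as A3.
  set (a0 := bm_d i (i + n)) in *. set (a1 := bm_d i (i + S n)) in *.
  set (a2 := bm_d i (i + S (S n))) in *. set (a3 := bm_d i (i + S (S (S n)))) in *.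
  clearbody a0 a1 a2 a3.
  set (c := 4 * (M - 1) * (M + 1) * (M - INR i + 1) * (M - 1 - INR i)
            * (M ^ 2 * (M - INR i) ^ 2) / (a0 * a1 ^ 2 * a2)).
  assert (Hc : 0 < c).
  { unfold c. apply Rdiv_lt_0_compat.
    - repeat apply Rmult_lt_0_compat; try apply pow_lt; unfold M; lra.
    - repeat first [assumption | apply pow_lt | apply Rmult_lt_0_compat]. }
  apply Rmult_lt_reg_l with c; [exact Hc|].
  eapply Rle_lt_trans; [|eapply Rlt_le_trans; [exact R|]];
    right; unfold c, M; field; lra.
Qed.

(** * Roots of ratio log-convex sequences *)

Lemma nroot_log_convex (a : nat -> R) :
  (forall n, 0 < a n) -> 1 <= a 0%nat ->
  (forall n, a n * a (S (S n)) ^ 3 < a (S (S (S n))) * a (S n) ^ 3) ->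
  forall n, (1 <= n)%nat ->
  nroot (S n) (a (S n)) / nroot n (a n)
  < nroot (S (S n)) (a (S (S n))) / nroot (S n) (a (S n)).
Proof.
  intros Hpos H0 Hconv.
  set (L := fun n => ln (a n)).
  assert (HL : forall n, L n + 3 * L (S (S n)) < L (S (S (S n))) + 3 * L (S n)).
  (* Taking logarithms makes the third difference of [L] positive. *)
  { intros n. pose proof (ln_increasing _ _
      (Rmult_lt_0_compat _ _ (Hpos n) (pow_lt _ 3 (Hpos (S (S n))))) (Hconv n)) as H.
    rewrite !ln_mult, !ln_pow in H by (try apply pow_lt; apply Hpos).
    simpl INR in H. unfold L. lra. }
  (* [D n] is [n (n+1) (n+2)] times the second difference of [ln (a n) / n];
     [D (n+1) - D n] is [(n+1) (n+2)] times the third difference of [ln (a n)]. *)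
  set (D := fun n => (INR n + 1) * (INR n + 2) * L n
              - 2 * INR n * (INR n + 2) * L (S n) + INR n * (INR n + 1) * L (S (S n))).
  assert (HD : forall n, D n < D (S n)).
  { intros n. unfold D. rewrite S_INR. pose proof (pos_INR n) as Hn.
    pose proof (Rmult_lt_compat_l ((INR n + 1) * (INR n + 2)) _ _
      ltac:(nra) (HL n)) as H. lra. }
  assert (HDpos : forall n, 0 < D (S n)).
  { intros n. induction n as [|n IH].
    - apply Rle_lt_trans with (D 0%nat); [|apply HD].
      assert (0 <= L 0%nat).
      { unfold L. rewrite <- ln_1. destruct H0 as [H0 | H0].
        - left. apply ln_increasing; lra.
        - right. now rewrite H0. }
      unfold D. simpl INR. lra.
    - apply Rlt_trans with (1 := IH). apply HD. }
  intros [|n] Hn; [lia|]. specialize (HDpos n).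
  assert (Hn0 : 0 < INR (S n)) by (apply lt_0_INR; lia).
  unfold nroot, Rpower. fold (L (S n)) (L (S (S n))) (L (S (S (S n)))).
  unfold Rdiv. rewrite <- !exp_Ropp, <- !exp_plus. apply exp_increasing.
  rewrite (S_INR (S (S n))), (S_INR (S n)). unfold D in HDpos.
  set (x := INR (S n)) in *.
  (* The difference of exponents is the second difference of [L n / n]. *)
  apply Rlt_0_minus.
  replace (_ - _) with (((x + 1) * (x + 2) * L (S n)
    - 2 * x * (x + 2) * L (S (S n)) + x * (x + 1) * L (S (S (S n))))
    / (x * (x + 1) * (x + 2))) by (field; lra).
  apply Rdiv_lt_0_compat; [exact HDpos|].
  repeat apply Rmult_lt_0_compat; lra.
Qed.

Theorem theorem5p2 : forall i n : nat, (1 <= i)%nat -> (1 <= n)%nat ->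
  nroot (S n) (bm_d i (i + S n)) / nroot n (bm_d i (i + n))
  < nroot (S (S n)) (bm_d i (i + S (S n))) / nroot (S n) (bm_d i (i + S n)).
Proof.
  intros i n Hi. apply (nroot_log_convex (fun n => bm_d i (i + n))).
  - apply bm_d_pos.
  - apply bm_d_diag_ge1.
  - intros k. now apply bm_d_ratio_log_convex.
Qed.
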